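(* Let $X$ be a real Banach space, let $f\in\Gamma(X)$, and let $\bar x\in X$ and $\bar y^*\in X^*$ be such that $\bar y^*\in\partial f(\bar x)$. Then $\partial f$ is metrically subregular at $\bar x$ for $\bar y^*$ if and only if there exist a neighborhood $U$ of $\bar x$ and a positive constant $c$ such that $$f(x)\geq f(\bar x)+\langle \bar y^*,x-\bar x\rangle +c\,d^2\big(x,(\partial f)^{-1}(\bar y^* )\big)\quad\text{whenever } x\in U. \qquad ( * )$$ Specifically, if $\partial f$ is metrically subregular at $\bar x$ for $\bar y^*$ with constant $\kappa>0$, then for every $c<1/(4\kappa)$ the inequality $( * )$ holds (on some neighborhood $U$ of $\bar x$); conversely, if $( * )$ holds with constant $c>0$ (on some neighborhood $U$ of $\bar x$), then $\partial f$ is metrically subregular at $\bar x$ for $\bar y^*$ with constant $1/c$.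
   Context: $X^*$ is the dual of $X$. $\Gamma(X)$ is the set of all proper (i.e. with nonempty domain), lower semicontinuous, convex functions $f:X\to\mathbb{R}\cup\{\infty\}$; $\operatorname{dom} f=\{x: f(x)<\infty\}$. The subdifferential is the set-valued mapping $\partial f:X\rightrightarrows X^*$, $\partial f(x)=\{y^*\in X^*: f(z)\geq f(x)+\langle y^*,z-x\rangle \text{ for all } z\in X\}$ for $x\in\operatorname{dom} f$, and $\partial f(x)=\emptyset$ otherwise. For a set-valued mapping $F$, $F^{-1}(y)=\{x: y\in F(x)\}$. The distance is $d(x,C)=\inf_{y\in C}\|x-y\|$, with $d(x,\emptyset)=\infty$; $d^2(x,C)$ means $(d(x,C))^2$. A set-valued mapping $F:X\rightrightarrows Y$ between Banach spaces is metrically subregular at $\bar x$ for $\bar y$ (with constant $\kappa$) if $\bar y\in F(\bar x)$ and there are $\kappa>0$ and neighborhoods $U$ of $\bar x$ and $V$ of $\bar y$ such that $d(x,F^{-1}(\bar y))\leq\kappa\, d(\bar y,F(x)\cap V)$ for all $x\in U$. *)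

(* Defs.v *)
From HB Require Import structures.
From mathcomp Require Import all_boot all_order all_algebra.
From mathcomp Require Import all_classical all_reals all_analysis.

Set Implicit Arguments.
Unset Strict Implicit.
Unset Printing Implicit Defensive.

Import Order.TTheory GRing.Theory Num.Theory.
Import numFieldNormedType.Exports.

Local Open Scope classical_set_scope.
Local Open Scope ring_scope.

Section topological_dual.
Context {R : realType} (X : normedModType R).

Definition linear_continuous_pred : {pred X -> R^o} :=
  [pred phi : X -> R^o | `[< linear phi /\ continuous phi >]].

Lemma linear_continuous_predP (phi : X -> R^o) :
  reflect (linear phi /\ continuous phi) (phi \in linear_continuous_pred).
Proof. exact: asboolP. Qed.

Record dual := Dual {
  dual_fun :> X -> R^o;
  dual_funP : dual_fun \in linear_continuous_pred }.

HB.instance Definition _ := [isSub for dual_fun].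
HB.instance Definition _ := [Choice of dual by <:].

Lemma linear_continuous_submod_closed : submod_closed linear_continuous_pred.
Proof.
split.
  apply/linear_continuous_predP; split; last exact: cst_continuous.
  by move=> a x y; rewrite scaler0 addr0.
move=> a phi psi /linear_continuous_predP[lphi cphi].
move=> /linear_continuous_predP[lpsi cpsi].
apply/linear_continuous_predP; split.
  move=> b x y; rewrite !fctE lphi lpsi !scalerDr !scalerA (mulrC a) -!addrA.
  by congr (_ + _); rewrite addrCA.
move=> x; apply: (@cvgD _ R^o); last exact: cpsi.
by apply: (@cvgZl_tmp _ R^o); exact: cphi.
Qed.

HB.instance Definition _ := GRing.isSubmodClosed.Build _ _
  linear_continuous_pred linear_continuous_submod_closed.
HB.instance Definition _ := [SubChoice_isSubLmodule of dual by <:].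

Lemma dual_linear (phi : dual) : linear phi.
Proof. by have /linear_continuous_predP[] := dual_funP phi. Qed.

Lemma dual_continuous (phi : dual) : continuous phi.
Proof. by have /linear_continuous_predP[] := dual_funP phi. Qed.

HB.instance Definition _ (phi : dual) :=
  GRing.isLinear.Build R X R^o *:%R (dual_fun phi) (dual_linear phi).

Definition dual_norm (phi : dual) : R :=
  sup [set `|phi x| | x in [set x : X | `|x| <= 1]].

Lemma dual_norm_has_sup (phi : dual) :
  has_sup [set `|phi x| | x in [set x : X | `|x| <= 1]].
Proof.
split; first by exists `|phi 0|; exists 0 => //=; rewrite normr0.
have /linear_bounded_continuous/bounded_funP/(_ 1)[M Mphi] :=
  @dual_continuous phi.
by exists M => _ [x /= x1 <-]; exact: Mphi.
Qed.

Lemma dual_norm_ub (phi : dual) (x : X) : `|phi x| <= dual_norm phi * `|x|.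
Proof.
have [->|x0] := eqVneq x 0; first by rewrite linear0 !normr0 mulr0.
have nx0 : 0 < `|x| by rewrite normr_gt0.
rewrite -ler_pdivrMr//.
apply: (sup_upper_bound (dual_norm_has_sup phi)).
exists (`|x|^-1 *: x) => /=.
  by rewrite normrZ normfV normr_id mulVf ?gt_eqF.
by rewrite linearZ/= normrM normfV normr_id mulrC.
Qed.

Lemma dual_norm_le (phi : dual) (M : R) :
  (forall x, `|x| <= 1 -> `|phi x| <= M) -> dual_norm phi <= M.
Proof.
move=> phiM; apply: ge_sup; first by case: (dual_norm_has_sup phi).
by move=> _ [x /= x1 <-]; exact: phiM.
Qed.

Lemma dual_norm_ge0 (phi : dual) : 0 <= dual_norm phi.
Proof.
apply: (sup_upper_bound (dual_norm_has_sup phi)).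
by exists 0; rewrite /= ?linear0 normr0.
Qed.

Lemma dual_norm_ball (phi : dual) (x : X) :
  `|x| <= 1 -> `|phi x| <= dual_norm phi.
Proof.
move=> x1; apply: (le_trans (dual_norm_ub phi x)).
by rewrite ler_piMr// dual_norm_ge0.
Qed.

Lemma ler_dual_normD (phi psi : dual) :
  dual_norm (phi + psi) <= dual_norm phi + dual_norm psi.
Proof.
apply: dual_norm_le => x x1.
by apply: (le_trans (ler_normD _ _)); rewrite lerD// dual_norm_ball.
Qed.

Lemma dual_normZ (a : R) (phi : dual) :
  dual_norm (a *: phi) = `|a| * dual_norm phi.
Proof.
have le_normZ (b : R) (psi : dual) :
    dual_norm (b *: psi) <= `|b| * dual_norm psi.
  apply: dual_norm_le => x x1.
  by rewrite [X in `|X|]/(b * psi x) normrM ler_wpM2l// dual_norm_ball.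
apply/eqP; rewrite eq_le le_normZ/=.
have [->|a0] := eqVneq a 0; first by rewrite normr0 mul0r dual_norm_ge0.
rewrite -ler_pdivlMl ?normr_gt0//.
by rewrite -normfV -{1}[phi](scalerK a0) le_normZ.
Qed.

Lemma dual_norm0_eq0 (phi : dual) : dual_norm phi = 0 -> phi = 0.
Proof.
move=> phi0; apply/val_inj/funext => x; apply/eqP.
by rewrite -normr_le0; apply: (le_trans (dual_norm_ub phi x)); rewrite phi0 mul0r.
Qed.

HB.instance Definition _ := Lmodule_isNormed.Build R dual
  ler_dual_normD dual_normZ dual_norm0_eq0.

End topological_dual.

Section extended_real_functions.
Context {R : realType} {X : normedModType R}.
Implicit Types f : X -> \bar R.
Local Open Scope ereal_scope.

Definition edom f : set X := [set x | f x < +oo].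

Definition econvex f := forall (x y : X) (t : R), (0 < t < 1)%R ->
  f (t *: x + (1 - t) *: y)%R <= t%:E * f x + (1 - t)%:E * f y.

(* The first conjunct says that [f] takes its values in R \cup {+oo}. *)
Definition Gamma f :=
  [/\ forall x, f x != -oo, edom f !=set0, lower_semicontinuous f & econvex f].

Definition subdifferential f (x : X) : set (dual X) :=
  [set y | edom f x /\ forall z, f x + (y (z - x)%R)%:E <= f z].

End extended_real_functions.

(* Set-valued mappings from X to Y are functions X -> set Y. *)
Definition svinv {X Y : Type} (F : X -> set Y) (y : Y) : set X :=
  [set x | F x y].

(* The infimum is taken in \bar R, so that [edist_to x set0 = +oo]. *)
Definition edist_to {R : realType} {X : normedModType R} (x : X) (C : set X) :
  \bar R := ereal_inf [set `|x - y|%:E | y in C].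

Section metric_subregularity.
Context {R : realType} {X Y : normedModType R}.
Implicit Types (F : X -> set Y) (xbar : X) (ybar : Y) (kappa : R).
Local Open Scope ereal_scope.

Definition metrically_subregular_with F xbar ybar kappa :=
  [/\ F xbar ybar, (0 < kappa)%R &
    exists U V, [/\ nbhs xbar U, nbhs ybar V &
      forall x, U x ->
        edist_to x (svinv F ybar) <= kappa%:E * edist_to ybar (F x `&` V)]].

Definition metrically_subregular F xbar ybar :=
  exists kappa, metrically_subregular_with F xbar ybar kappa.

End metric_subregularity.

Definition quadratic_growth_on {R : realType} {X : normedModType R}
    (f : X -> \bar R) (xbar : X) (ybar : dual X) (c : R) (U : set X) :=
  forall x, U x ->
    (f xbar + (ybar (x - xbar)%R)%:E
       + c%:E * edist_to x (svinv (subdifferential f) ybar) ^+ 2 <= f x)%E.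

(* Main.v *)
Require Import Defs.
From HB Require Import structures.
From mathcomp Require Import all_boot all_order all_algebra.
From mathcomp Require Import all_classical all_reals all_analysis.
From mathcomp Require Import ring lra.

Set Implicit Arguments.
Unset Strict Implicit.
Unset Printing Implicit Defensive.

Import Order.TTheory GRing.Theory Num.Theory.
Import numFieldNormedType.Exports.

Local Open Scope classical_set_scope.
Local Open Scope ring_scope.

(* Let S be the set of points where ybar is a subgradient and d = d(x, S).

   If quadratic growth with constant c < 1/(4 kappa) fails at some x near xbar,
   then ybar is a (c d^2)-subgradient of f at x, and d > 0.  The
   Brondsted-Rockafellar theorem with slope k = 2 c d gives a point u with
   |u - x| <= d/2 and a subgradient y of f at u with |y - ybar| <= 2 c d.
   Subregularity at u then yields d <= d/2 + 2 kappa c d < d.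

   Conversely, if y is a subgradient at x and z is in S, then adding the
   subgradient inequality of y at x to the growth inequality, whose affine part
   agrees with f at z, gives c d^2 <= (y - ybar)(x - z) <= |y - ybar| |x - z|;
   take the infimum over z. *)

(** * Hahn-Banach theorem for sublinear functions, through Zorn's lemma *)

Section hahn_banach.
Context {R : realType} {V : lmodType R}.
Implicit Types p q : V -> R.

(** Homogeneity is an inequality only, which is less to check; applying it again with t^-1 gives the
    equality ([sublinearZ]). *)
Definition sublinear q :=
  (forall x y, q (x + y) <= q x + q y) /\
  (forall (t : R) x, 0 < t -> q (t *: x) <= t * q x).

Lemma sublinearZ q (t : R) x : sublinear q -> 0 < t -> q (t *: x) = t * q x.
Proof.
move=> [_ qZ] t0; apply/eqP; rewrite eq_le qZ//=.
have := qZ t^-1 (t *: x); rewrite invr_gt0 => /(_ t0).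
by rewrite scalerA mulVf ?gt_eqF// scale1r ler_pdivlMl.
Qed.

Lemma sublinear0 q : sublinear q -> q 0 = 0.
Proof.
move=> qs; have := @sublinearZ q 2 0 qs (ltr0Sn _ _).
by rewrite scaler0; lra.
Qed.

Lemma sublinear_geN q x : sublinear q -> - q (- x) <= q x.
Proof.
by move=> qs; have := qs.1 x (- x); rewrite subrr sublinear0// lerNl; lra.
Qed.

(** Provides the bounds of chains for Zorn's lemma. The infimum is finite since q x >= - q (- x) >=
    - p (- x). It is subadditive because, of two members q and r of the chain, the smaller one at x
    + y is at most q x + r y. *)
Lemma chain_inf_sublinear p (A : set (V -> R)) : A !=set0 ->
  (forall q, A q -> sublinear q /\ forall x, q x <= p x) ->
  (forall q r, A q -> A r ->
    (forall x, q x <= r x) \/ (forall x, r x <= q x)) ->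
  let m x := inf [set q x | q in A] in
  sublinear m /\ forall q x, A q -> m x <= q x.
Proof.
move=> [q0 Aq0] Ap Atot m.
have mle q x : A q -> m x <= q x.
  move=> Aq; apply: ge_inf; last by exists q.
  exists (- p (- x)) => _ [r Ar <-]; have [rs rp] := Ap r Ar.
  by apply: le_trans (sublinear_geN x rs); rewrite lerN2.
have lem x a : (forall q, A q -> a <= q x) -> a <= m x.
  move=> aq; apply: lb_le_inf; first by exists (q0 x), q0.
  by move=> _ [q Aq <-]; exact: aq.
split=> //; split=> [x y|t x t0].
  rewrite -lerBlDr; apply: (lem x) => q Aq; rewrite lerBlDr -lerBlDl.
  apply: (lem y) => r Ar; rewrite lerBlDl.
  have [qr|rq] := Atot q r Aq Ar.
    apply: (le_trans (mle q _ Aq)); apply: (le_trans ((Ap q Aq).1.1 _ _)).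
    by rewrite lerD2l.
  apply: (le_trans (mle r _ Ar)); apply: (le_trans ((Ap r Ar).1.1 _ _)).
  by rewrite lerD2r.
rewrite -ler_pdivrMl//; apply: (lem x) => q Aq; rewrite ler_pdivrMl//.
by apply: (le_trans (mle q _ Aq)); exact: (Ap q Aq).1.2.
Qed.

(* [x |-> inf_(t >= 0) q (x + t y) - t q y] is a sublinear function below [q],
   hence equal to [q]; bounding it by its term at t = 1 gives
   superadditivity. *)
Lemma minimal_sublinear_additive q : sublinear q ->
  (forall r, sublinear r -> (forall x, r x <= q x) -> r = q) ->
  forall x y, q (x + y) = q x + q y.
Proof.
move=> qs qmin x y; apply/eqP; rewrite eq_le qs.1/=.
pose S z := [set q (z + t *: y) - t * q y | t in [set t : R | 0 <= t]].
pose r z := inf (S z).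
have qZ t z : 0 <= t -> q (t *: z) = t * q z.
  rewrite le_eqVlt => /predU1P[<-|]; last exact: sublinearZ.
  by rewrite scale0r mul0r sublinear0.
have rle z t : 0 <= t -> r z <= q (z + t *: y) - t * q y.
  move=> t0; apply: ge_inf; last by exists t.
  exists (- q (- z)) => _ [s /= s0 <-].
  by have := qs.1 (z + s *: y) (- z); rewrite addrC addKr qZ//; lra.
have ler z a : (forall t, 0 <= t -> a <= q (z + t *: y) - t * q y) -> a <= r z.
  move=> az; apply: lb_le_inf.
    by exists (q (z + 0 *: y) - 0 * q y), 0 => /=.
  by move=> _ [t /= t0 <-]; exact: az.
have rs : sublinear r.
  split=> [z w|s z s0].
    rewrite -lerBlDr; apply: (ler z) => t t0; rewrite lerBlDr -lerBlDl.
    apply: (ler w) => t' t'0; rewrite lerBlDl.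
    apply: (le_trans (rle _ (t + t') _)); first exact: addr_ge0.
    have := qs.1 (z + t *: y) (w + t' *: y).
    by rewrite addrACA -scalerDl; lra.
  rewrite -ler_pdivrMl//; apply: (ler z) => t t0; rewrite ler_pdivrMl//.
  apply: (le_trans (rle _ (s * t) _)); first by rewrite mulr_ge0// ltW.
  by rewrite -scalerA -scalerDr sublinearZ// mulrBr mulrA.
have rq : r = q.
  apply: qmin => // z; have := rle z 0 (lexx _).
  by rewrite scale0r mul0r addr0 subr0.
by have := rle x 1 ler01; rewrite rq scale1r mul1r lerBrDr.
Qed.

(** A pointwise minimal sublinear function below [p] is additive, hence odd, hence linear. [Rel]
    reverses the pointwise order, so that a maximal element for it is minimal pointwise; the empty
    chain is bounded by [p] itself. *)
Lemma hahn_banach p : sublinear p ->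
  exists phi : V -> R^o, linear phi /\ forall x, phi x <= p x.
Proof.
move=> ps; pose T := {q | sublinear q /\ forall x, q x <= p x}.
pose Rel : rel T := fun a b => `[< forall x, sval b x <= sval a x >].
have [||||[q [qs qp]] qmin] := @Zorn T Rel.
- by move=> q; apply/asboolP.
- move=> q r s /asboolP qr /asboolP rs; apply/asboolP => x.
  exact: le_trans (rs x) (qr x).
- move=> [q q'] [r r'] /asboolP /= qr /asboolP /= rq; apply: eq_exist => /=.
  by apply/funext => x; apply/eqP; rewrite eq_le rq qr.
- move=> A Atot; have [[[q0 q0P] Aq0]|A0] := pselect (A !=set0); last first.
    exists (exist _ p (conj ps (fun=> lexx _))) => s As.
    by case: A0; exists s.
  pose B : set (V -> R) := [set sval a | a in A].
  have [|||ms mle] := @chain_inf_sublinear p B.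
  + by exists q0, (exist _ q0 q0P).
  + by move=> _ [[q qP] _ <-].
  + move=> _ _ [a Aa <-] [b Ab <-].
    by have [/asboolP ab|/asboolP ba] := Atot a b Aa Ab; [right|left].
  have Bq0 : B q0 by exists (exist _ q0 q0P).
  have mp x : inf [set q x | q in B] <= p x.
    exact: le_trans (mle _ x Bq0) (q0P.2 x).
  exists (exist _ (fun x => inf [set q x | q in B]) (conj ms mp)).
  by move=> s As; apply/asboolP => x /=; apply: mle; exists s.
have qD : forall x y, q (x + y) = q x + q y.
  apply: minimal_sublinear_additive => // r rs rq.
  have rp x : r x <= p x by exact: le_trans (rq x) (qp x).
  by have /(congr1 sval) := qmin (exist _ r (conj rs rp)) (asboolT rq).
have qN x : q (- x) = - q x.
  by apply/eqP; rewrite -addr_eq0 addrC -qD subrr sublinear0.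
exists q; split=> // a x y; rewrite qD; congr (_ + _).
have [a0|a0|->] := ltgtP a 0; last by rewrite !scale0r sublinear0.
- rewrite -[a]opprK scaleNr qN sublinearZ ?oppr_gt0//.
  by rewrite mulNr opprK [RHS]/GRing.scale/= opprK.
- exact: sublinearZ.
Qed.
End hahn_banach.

(** * Ekeland's variational principle *)

Section ekeland.
Context {R : realType} {X : completeNormedModType R}.
Variables (f : X -> \bar R) (m k : R).
Hypotheses (f_lsc : lower_semicontinuous f) (f_ge : forall x, (m%:E <= f x)%E).
Hypothesis k0 : 0 < k.

(** The points below [x] in Ekeland's order, which is transitive by the triangle inequality. *)
Let S (x : X) : set X := [set w | (f w + (k * `|w - x|)%:E <= f x)%E].

Let Sxx x : S x x.
Proof. by rewrite /S/= subrr normr0 mulr0 adde0. Qed.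

Let S_le x w : S x w -> (f w <= f x)%E.
Proof.
by apply: le_trans; rewrite leeDl// lee_fin mulr_ge0// ltW.
Qed.

Let S_trans x w z : S x w -> S w z -> S x z.
Proof.
rewrite /S/= => xw wz; apply: le_trans xw; apply: le_trans (leeD2r _ wz).
rewrite -addeA leeD2l// -EFinD lee_fin -mulrDr ler_pM2l//.
by rewrite -[z - x](subrKA w) ler_normD.
Qed.

Let fin x : (f x < +oo)%E -> f x \is a fin_num.
Proof. by move=> fx; rewrite fin_numElt fx (lt_le_trans _ (f_ge x)) ?ltNyr. Qed.

Let S_almost_min x (e : R) : (f x < +oo)%E -> 0 < e ->
  exists2 x', S x x' & forall w, S x w -> (f x' <= f w + e%:E)%E.
Proof.
move=> fx e0; have ifin : ereal_inf (f @` S x) \is a fin_num.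
  rewrite fin_numElt; apply/andP; split.
    apply: (@lt_le_trans _ _ m%:E); first exact: ltNyr.
    by apply: le_ereal_inf_tmp => _ [w _ <-].
  by apply: le_lt_trans fx; apply: ereal_inf_lbound; exists x.
have [_ [x' Sx' <-] /ltW x'le] := lb_ereal_inf_adherent e0 ifin.
exists x' => // w Sw; apply: (le_trans x'le); rewrite leeD2r//.
by apply: ereal_inf_lbound; exists w.
Qed.

(** A sequence descending in Ekeland's order converges to a point [u] of every [S (x_ n)]. If [w]
    violates the strict inequality at [u], then [w] is in [S u], hence in every [S (x_ n)]; almost
    minimality gives f u <= f w, which forces w = u. *)
Lemma ekeland (x0 : X) : (f x0 < +oo)%E ->
  exists2 u, (f u + (k * `|u - x0|)%:E <= f x0)%E &
    forall w, w != u -> (f u < f w + (k * `|w - u|)%:E)%E.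
Proof.
move=> fx0; pose e n : R := n.+1%:R^-1.
(* The finiteness premise stands under the existential so that [next] is total; its values off the
   domain are arbitrary. *)
have /choice[next nextP] (nx : nat * X) : exists x', (f nx.2 < +oo)%E ->
    S nx.2 x' /\ forall w, S nx.2 w -> (f x' <= f w + (e nx.1)%:E)%E.
  case: nx => n x /=; have [fx|fx] := pselect (f x < +oo)%E; last by exists x.
  have e0 : 0 < e n by rewrite invr_gt0.
  by have [x' Sx' x'min] := S_almost_min fx e0; exists x'.
(* [x_ n.+1] almost minimizes [f] over [S (x_ n)], so that the diameters of the
   decreasing sets [S (x_ n)] tend to 0. *)
pose x_ := fix x_ n := if n is n'.+1 then next (n', x_ n') else x0.
have fx n : (f (x_ n) < +oo)%E.
  elim: n => [//|n IH]; exact: le_lt_trans (S_le (nextP (n, x_ n) IH).1) IH.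
have xS n : S (x_ n) (x_ n.+1) by exact: (nextP (n, x_ n) (fx n)).1.
have xmin n w : S (x_ n) w -> (f (x_ n.+1) <= f w + (e n)%:E)%E.
  exact: (nextP (n, x_ n) (fx n)).2.
have S_le_n n i : S (x_ n) (x_ (i + n)%N).
  elim: i => [|i IH]; first exact: Sxx.
  by rewrite addSn; apply: S_trans IH _; exact: xS.
have S_diam n w : S (x_ n.+1) w -> k * `|w - x_ n.+1| <= e n.
  move=> Sw; have := xmin n w (S_trans (xS n) Sw).
  have fw : (f w < +oo)%E by apply: le_lt_trans (S_le Sw) (fx _).
  move: Sw; rewrite /S/= -(fineK (fin fw)) -(fineK (fin (fx n.+1))).
  by rewrite -!EFinD !lee_fin; lra.
have e_small d : 0 < d -> \forall n \near \oo, e n < d.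
  by move=> d0; exact: (near_infty_natSinv_lt (PosNum d0)).
(* The tail from N + 1 on lies in [S (x_ N.+1)], whose points are within e N / k of [x_ N.+1]. *)
have /cauchy_cvg xcvg : cauchy (x_ @ \oo).
  apply: cauchy_exP => d d0; have kd0 : 0 < k * d by rewrite mulr_gt0.
  have [N _ /(_ N (leqnn _)) eN] := e_small _ kd0.
  exists (x_ N.+1), N.+1 => // n /= Nn.
  rewrite -ball_normE/= distrC -(ltr_pM2l k0); apply: le_lt_trans eN.
  by apply: S_diam; rewrite -(subnK Nn).
set u := lim (x_ @ \oo) in xcvg.
(* [S (x_ n)] is closed: otherwise some [a] lies strictly between f (x_n) - k |u - x_n| and f u, and
   f > a near u by semicontinuity. But f (x_i) <= f (x_n) - k |x_i - x_n| <= a as soon as |u - x_i|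
   <= d. *)
have Su n : S (x_ n) u.
  rewrite /S/= leNgt; apply/negP => ltfu.
  have lt_u : ((fine (f (x_ n)) - k * `|u - x_ n|)%:E < f u)%E.
    by rewrite EFinB fineK ?fin// lteBlDr.
  have [a na au] : exists2 a : R,
      fine (f (x_ n)) - k * `|u - x_ n| < a & (a%:E < f u)%E.
    move: lt_u; case: (f u) => [r| |] //.
      rewrite lte_fin => lt_r.
      exists ((fine (f (x_ n)) - k * `|u - x_ n| + r) / 2).
        by rewrite midf_lt.
      by rewrite lte_fin midf_lt.
    move=> _; exists (fine (f (x_ n)) - k * `|u - x_ n| + 1); last exact: ltry.
    by rewrite ltrDl.
  have [W uW Wa] := f_lsc au.
  pose d := (a - (fine (f (x_ n)) - k * `|u - x_ n|)) / k.
  have d0 : 0 < d by rewrite divr_gt0// subr_gt0.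
  near \oo => i.
  have uxi : `|u - x_ i| <= d by near: i; exact: cvgr_dist_le.
  have Wi : W (x_ i) by near: i; exact: xcvg.
  have ni : (n <= i)%N by near: i; exact: nbhs_infty_ge.
  have := S_le_n n (i - n)%N; rewrite subnK// /S/= -(fineK (fin (fx i))).
  rewrite -(fineK (fin (fx n))) -EFinD lee_fin leNgt => /negP; apply.
  have := Wa _ Wi; rewrite -(fineK (fin (fx i))) lte_fin.
  move: uxi; rewrite ler_pdivlMr// => uxi.
  have := ler_distD (x_ i) u (x_ n); rewrite -(ler_pM2l k0) mulrDr; lra.
have fu n : (f u <= f (x_ n))%E by exact: S_le.
exists u => [|w]; first exact: Su 0%N.
apply: contra_neqT; rewrite -leNgt => Suw.
have fw : f w \is a fin_num.
  by apply: fin; apply: le_lt_trans (S_le Suw) (le_lt_trans (fu 0%N) fx0).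
have ufin : f u \is a fin_num by apply: fin; exact: le_lt_trans (fu 0%N) fx0.
have uw : (f u <= f w)%E.
  apply/lee_addgt0Pr => d d0; have [N _ /(_ N (leqnn _)) eN] := e_small _ d0.
  apply: (le_trans (fu N.+1)); apply: (le_trans (xmin N w _)).
    exact: S_trans (Su N) Suw.
  by rewrite leeD2l// lee_fin ltW.
apply/eqP; rewrite -subr_eq0 -normr_le0 -(pmulr_rle0 _ k0).
move: Suw uw; rewrite /S/= -(fineK fw) -(fineK ufin) -EFinD !lee_fin; lra.
Unshelve. all: by end_near.
Qed.
End ekeland.

(** * Elements of the dual from linear functionals dominated by the norm *)

Section dual_construction.
Context {R : realType} {X : normedModType R}.

Lemma dual_of_le_norm (phi : X -> R^o) (k : R) : 0 <= k -> linear phi ->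
  (forall x, phi x <= k * `|x|) ->
  exists2 y : dual X, `|y| <= k & forall x, y x = phi x.
Proof.
move=> k0 lphi phik.
pose L := HB.pack_for {linear X -> R^o} phi
  (GRing.isLinear.Build R X R^o *:%R phi lphi).
have absk x : `|phi x| <= k * `|x|.
  rewrite ler_norml phik andbT lerNl -[- phi x](linearN L).
  by rewrite -(normrN x); exact: phik.
have cphi : continuous phi.
  apply: (@bounded_linear_continuous _ _ _ L); apply/bounded_funP => r.
  exists (k * r) => x xr; apply: le_trans (absk x) _.
  by rewrite ler_wpM2l.
have phiP : phi \in @linear_continuous_pred R X.
  exact/linear_continuous_predP.
exists (Dual phiP) => //; apply: dual_norm_le => x x1.
by apply: le_trans (absk x) _; rewrite ler_piMr.
Qed.

End dual_construction.

(** * Fermat's rule for a convex function plus a multiple of the norm *)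

Section fermat_rule.
Context {R : realType} {X : normedModType R}.
Implicit Types f : X -> \bar R.

Lemma econvex_fine f x y (t : R) : (forall z, f z != -oo%E) -> econvex f ->
  edom f x -> edom f y -> 0 < t < 1 ->
  edom f (t *: x + (1 - t) *: y) /\
  fine (f (t *: x + (1 - t) *: y)) <= t * fine (f x) + (1 - t) * fine (f y).
Proof.
move=> fNy cf fx fy t01; have fin z : edom f z -> f z \is a fin_num.
  by move=> fz; rewrite fin_numElt fz ltNye fNy.
have := cf x y t t01; rewrite -(fineK (fin _ fx)) -(fineK (fin _ fy)).
rewrite -!EFinM -EFinD => le_xy.
have dxy : edom f (t *: x + (1 - t) *: y).
  by apply: le_lt_trans le_xy _; rewrite ltry.
by split => //; rewrite -lee_fin (fineK (fin _ dxy)).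
Qed.

(** Hahn-Banach yields a linear functional below [q]. Taking t = 1 in [val], the choice w = 0 bounds
    it by k |h|, hence its norm by k, and the choice w = h bounds it by f (u + h) - f u, which is
    the subgradient inequality. *)
Lemma subdifferential_almost_min f (u : X) (k : R) :
  (forall x, f x != -oo%E) -> econvex f -> edom f u -> 0 <= k ->
  (forall w, (f u <= f w + (k * `|w - u|)%:E)%E) ->
  exists2 y, subdifferential f u y & `|y| <= k.
Proof.
move=> fNy cf fu k0 umin; pose F x := fine (f x).
have fin z : edom f z -> f z = (F z)%:E.
  by move=> fz; rewrite fineK// fin_numElt fz ltNye fNy.
have Fmin w : edom f (u + w) -> F u - k * `|w| <= F (u + w).
  move=> fw; have := umin (u + w); rewrite (fin _ fu) (fin _ fw) -EFinD lee_fin.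
  by rewrite [u + w - u]addrAC subrr add0r lerBlDr.
(* The conical hull of the infimal convolution of [f (u + _) - f u] and
   [k * `|_|]. *)
pose val h t w := t * (F (u + w) - F u) + k * `|h - t *: w|.
pose S h := [set r | exists t w, [/\ 0 < t, edom f (u + w) & r = val h t w]].
pose q h := inf (S h).
have qle h t w : 0 < t -> edom f (u + w) -> q h <= val h t w.
  move=> t0 fw; apply: ge_inf; last by exists t, w.
  (* The hypothesis on [u] enters here: the first term of [val] is at least - k |s z|, and |s z| <=
     |h - s z| + |h|. *)
  exists (- (k * `|h|)) => _ [s [z [s0 /Fmin Fz ->]]]; rewrite /val.
  have : `|s *: z| <= `|h - s *: z| + `|h|.
    by rewrite -{1}(subKr h (s *: z)) (le_trans (ler_normB _ _))// addrC.
  rewrite normrZ gtr0_norm// => le1.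
  have := ler_wpM2l k0 le1.
  have : s * (- (k * `|z|)) <= s * (F (u + z) - F u) by rewrite ler_pM2l//; lra.
  lra.
have leq h a :
    (forall t w, 0 < t -> edom f (u + w) -> a <= val h t w) -> a <= q h.
  move=> aval; apply: lb_le_inf.
    by exists (val h 1 0), 1, 0; rewrite addr0.
  by move=> _ [t [w [t0 fw ->]]]; exact: aval.
have qs : sublinear q.
  split=> [h1 h2|s h s0].
    rewrite -lerBlDr; apply: (leq h1) => t1 w1 t10 fw1.
    rewrite lerBlDr -lerBlDl; apply: (leq h2) => t2 w2 t20 fw2; rewrite lerBlDl.
    have t0 : 0 < t1 + t2 by rewrite addr_gt0.
    (* These weights give (t1 + t2) w = t1 w1 + t2 w2, so convexity of [f] turns into subadditivity
       of [q]. *)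
    pose s := t1 / (t1 + t2); pose w := s *: w1 + (1 - s) *: w2.
    have s01 : 0 < s < 1 by rewrite divr_gt0//= ltr_pdivrMr// mul1r ltrDl.
    have uwE : u + w = s *: (u + w1) + (1 - s) *: (u + w2).
      by rewrite !scalerDr addrACA -scalerDl subrKC scale1r.
    have tsE : (t1 + t2) * s = t1 by rewrite mulrC divfK ?gt_eqF.
    have tsE' : (t1 + t2) * (1 - s) = t2 by rewrite mulrBr tsE; ring.
    have twE : (t1 + t2) *: w = t1 *: w1 + t2 *: w2.
      by rewrite scalerDr !scalerA tsE tsE'.
    have [fw Fw] := econvex_fine fNy cf fw1 fw2 s01.
    rewrite -uwE -!/(F _) in fw Fw.
    apply: le_trans (qle _ _ _ t0 fw) _; rewrite /val twE.
    have := ler_normD (h1 - t1 *: w1) (h2 - t2 *: w2).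
    rewrite addrACA -opprD => /(ler_wpM2l k0).
    have := ler_wpM2l (ltW t0) Fw.
    have -> a b : (t1 + t2) * (s * a + (1 - s) * b) = t1 * a + t2 * b.
      by rewrite mulrDr mulrA tsE mulrA tsE'.
    lra.
  rewrite -ler_pdivrMl//; apply: (leq h) => t w t0 fw; rewrite ler_pdivrMl//.
  apply: le_trans (qle _ (s * t) _ _ fw) _; first exact: mulr_gt0.
  rewrite /val -scalerA -scalerBr normrZ gtr0_norm//; lra.
have [phi [lphi phiq]] := hahn_banach qs.
have [|y yk yE] := dual_of_le_norm k0 lphi.
  move=> h; apply: le_trans (phiq h) _.
  apply: le_trans (qle h 1 0 ltr01 _) _; first by rewrite /edom/= addr0.
  by rewrite /val addr0 subrr mulr0 add0r scaler0 subr0.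
exists y => //; split=> //.
move=> z; have [fz|] := pselect (edom f z); last first.
  by move/negP; rewrite -leNgt leye_eq => /eqP ->; exact: leey.
rewrite (fin _ fu) (fin _ fz) -EFinD lee_fin yE.
have uz : u + (z - u) = z by rewrite subrKC.
apply: (@le_trans _ _ (F u + val (z - u) 1 (z - u))).
  by rewrite lerD2l (le_trans (phiq _))// qle// uz.
by rewrite /val uz mul1r scale1r subrr normr0 mulr0 addr0 subrKC.
Qed.

End fermat_rule.

(** * Distance to a set *)

Section edist_to.
Context {R : realType} {X : normedModType R}.
Implicit Types (x u : X) (C : set X).

Lemma edist_to_le x y C : C y -> (edist_to x C <= `|x - y|%:E)%E.
Proof. by move=> Cy; apply: ereal_inf_lbound; exists y. Qed.

Lemma edist_to_ge0 x C : (0 <= edist_to x C)%E.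
Proof. by apply: le_ereal_inf_tmp => _ [y _ <-]; rewrite lee_fin. Qed.

Lemma edist_to_fin_num x C : C !=set0 -> edist_to x C \is a fin_num.
Proof.
move=> [y Cy]; rewrite ge0_fin_numE ?edist_to_ge0//.
by rewrite (le_lt_trans (edist_to_le x Cy))// ltry.
Qed.

Lemma edist_to_triangle x u C :
  (edist_to x C <= `|x - u|%:E + edist_to u C)%E.
Proof.
rewrite addeC -leeBlDr//; apply: le_ereal_inf_tmp => _ [y Cy <-].
rewrite leeBlDr// (le_trans (edist_to_le x Cy))// -EFinD lee_fin [leRHS]addrC.
exact: ler_distD.
Qed.

End edist_to.

(** * Subtracting a continuous linear functional *)

Section linear_perturbation.
Context {R : realType} {X : normedModType R}.
Implicit Types (f : X -> \bar R) (phi y : dual X).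

Lemma dual_addE phi y x : (phi + y) x = phi x + y x :> R.
Proof. by []. Qed.

Lemma dual_subr phi x z : phi (x - z) = phi x - phi z :> R.
Proof. exact: linearB. Qed.

Lemma lower_semicontinuousB f phi : lower_semicontinuous f ->
  lower_semicontinuous (fun x => f x - (phi x)%:E)%E.
Proof.
move=> lf x a; rewrite lteBrDr// -EFinD => /[dup] ax.
(* The slack [b] absorbs the variation of [phi] near x: half the gap if f x is finite, 1
   otherwise. *)
have [b b0 bx] : exists2 b : R, 0 < b & ((a + phi x + b)%:E < f x)%E.
  case: (f x) ax => [r| |] //.
    rewrite lte_fin => ar; exists ((r - (a + phi x)) / 2).
      by rewrite divr_gt0// subr_gt0.
    by rewrite lte_fin; lra.
  by exists 1 => //; rewrite ltry.
move=> _; have [V xV Vb] := lf _ _ bx.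
have phib : \forall z \near x, `|phi x - phi z| <= b.
  by have /(@cvgr_dist_le _ R^o)/(_ _ b0) := @dual_continuous _ _ phi x.
exists (V `&` [set z | `|phi x - phi z| <= b]); first exact: filterI.
move=> z [Vz /=]; rewrite ler_norml => phiz; rewrite EFinN lteBrDr// -EFinD.
by apply: le_lt_trans (Vb _ Vz); rewrite lee_fin; lra.
Qed.

Lemma econvexB f phi : econvex f -> econvex (fun x => f x - (phi x)%:E)%E.
Proof.
move=> cf x y t t01; rewrite !muleBr ?fin_num_adde_defl// addeACA.
have -> : phi (t *: x + (1 - t) *: y) = t * phi x + (1 - t) * phi y.
  by rewrite linearD !linearZ.
by rewrite -!EFinM -!EFinN -EFinD -opprD leeD2r// cf.
Qed.

Lemma subdifferentialD f phi u y :
  subdifferential (fun x => f x - (phi x)%:E)%E u y ->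
  subdifferential f u (y + phi).
Proof.
move=> [fu yu]; split=> [|z].
  by move: fu; rewrite /edom/= EFinN lteBlDr// addye.
have := yu z; rewrite leeBrDr// => /(le_trans _); apply.
rewrite -!addeA leeD2l// -!EFinN -!EFinD lee_fin.
by rewrite dual_addE !dual_subr; lra.
Qed.

End linear_perturbation.

(** * The Brondsted-Rockafellar theorem *)

Section brondsted_rockafellar.
Context {R : realType} {X : completeNormedModType R}.

(** Ekeland's principle applies to g = f - phi, which is bounded below by m = g x - eps; hence k |u
    - x| <= g x - g u <= eps. Fermat's rule at [u] gives a subgradient of g of norm at most k, to
    which phi is added back. *)
Lemma brondsted_rockafellar (f : X -> \bar R) (x : X) (phi : dual X)
    (eps k : R) : Gamma f -> edom f x -> 0 < k ->
  (forall z, (f x + (phi (z - x))%:E <= f z + eps%:E)%E) ->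
  exists u y, [/\ subdifferential f u y, k * `|u - x| <= eps & `|y - phi| <= k].
Proof.
move=> [fNy _ lf cf] fx k0 phix; pose g z := (f z - (phi z)%:E)%E.
have fin z : edom f z -> f z = (fine (f z))%:E.
  by move=> fz; rewrite fineK// fin_numElt fz ltNye fNy.
pose m := fine (f x) - phi x - eps.
have gm z : (m%:E <= g z)%E.
  rewrite /g leeBrDr// -EFinD; have := phix z; rewrite (fin _ fx) -EFinD.
  rewrite -leeBlDr// -EFinN -EFinD; apply: le_trans.
  by rewrite lee_fin dual_subr /m/=; lra.
have gNy z : g z != -oo%E by rewrite -ltNye (lt_le_trans _ (gm z))// ltNyr.
have gx : (g x < +oo)%E by rewrite /g (fin _ fx) ltry.
have [u ux umin] := ekeland (lower_semicontinuousB lf) gm k0 gx.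
have gu : (g u < +oo)%E.
  apply: le_lt_trans gx; apply: le_trans ux.
  by rewrite leeDl// lee_fin mulr_ge0// ltW.
have cg : econvex g by exact: econvexB.
have [w|y yu yk] := subdifferential_almost_min gNy cg gu (ltW k0).
  have [->|/umin/ltW//] := eqVneq w u.
  by rewrite subrr normr0 mulr0 adde0.
exists u, (y + phi); split; last by rewrite addrK.
  exact: subdifferentialD.
have gufin : g u = (fine (g u))%:E by rewrite fineK// fin_numElt gu ltNye gNy.
move: (gm u) ux; rewrite -/(g u) (fin _ fx) gufin.
by rewrite -!EFinN -!EFinD !lee_fin /m; lra.
Qed.

End brondsted_rockafellar.

(** * Quadratic growth against subregularity of the subdifferential *)

Section growth_and_subregularity.
Context {R : realType} {X : completeNormedModType R}.
Variables (f : X -> \bar R) (xbar : X) (ybar : dual X).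
Hypotheses (fG : Gamma f) (ybarP : subdifferential f xbar ybar).
Let S := svinv (subdifferential f) ybar.

Let fin z : edom f z -> f z = (fine (f z))%:E.
Proof.
by case: fG => fNy _ _ _ fz; rewrite fineK// fin_numElt fz ltNye fNy.
Qed.

Let dist x : edist_to x S = (fine (edist_to x S))%:E.
Proof. by rewrite fineK// edist_to_fin_num//; exists xbar. Qed.

Lemma quadratic_growth_of_subregular kappa c : 0 < kappa ->
  metrically_subregular_with (subdifferential f) xbar ybar kappa ->
  c < 1 / (4 * kappa) ->
  exists2 U, nbhs xbar U & quadratic_growth_on f xbar ybar c U.
Proof.
move=> kappa0 [_ _ [U [V [xU yV subreg]]]] ckappa.
have [c0|c0] := leP c 0.
  exists setT; first exact: filterT.
  move=> x _; apply: le_trans (ybarP.2 x); rewrite -/S dist -EFin_expe -EFinM.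
  rewrite -[leRHS]adde0 leeD2l// lee_fin.
  by rewrite mulr_le0_ge0// sqr_ge0.
have [r r0 xr] := (nbhs_ballP _ _).1 xU.
have [s s0 ys] := (nbhs_ballP _ _).1 yV.
(* Since d <= |x - xbar| < rho, this gives |u - xbar| <= (3/2) |x - xbar| < r and |y - ybar| <= 2 c
   d < s, so that [u] falls in [U] and [y] in [V]. *)
pose rho := Num.min (r / 2) (s / (4 * c)).
have rho0 : 0 < rho by rewrite lt_min !divr_gt0// mulr_gt0.
exists (ball xbar rho); first exact: nbhsx_ballx.
move=> x xrho.
have /andP[xr2 xsc] : (`|xbar - x| < r / 2) && (`|xbar - x| < s / (4 * c)).
  by move: xrho; rewrite -ball_normE/= lt_min.
rewrite -/S dist -EFin_expe -EFinM leNgt; apply/negP => flt.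
set d := fine (edist_to x S) in flt.
have d0 : 0 <= d by rewrite -lee_fin -dist edist_to_ge0.
have dx : d <= `|xbar - x|.
  by rewrite -lee_fin -dist distrC edist_to_le.
have fx : edom f x.
  by apply: lt_trans flt _; rewrite (fin ybarP.1) -!EFinD ltry.
have dpos : 0 < d.
  rewrite lt_def d0 andbT; apply: contraTneq flt => ->.
  by rewrite expr0n/= mulr0 adde0 -leNgt ybarP.2.
have k0 : 0 < 2 * c * d by rewrite !mulr_gt0.
have [|u [y [yu ux yk]]] :=
  @brondsted_rockafellar _ _ f x ybar (c * d ^+ 2) _ fG fx k0.
  (* Failure of growth bounds f x above by the affine minorant at x plus c d^2, and the same
     minorant bounds f z below. *)
  move=> z; apply: le_trans (leeD2r _ (ybarP.2 z)).
  move: flt; rewrite (fin ybarP.1) (fin fx) -!EFinD lte_fin lee_fin !dual_subr.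
  lra.
have {}ux : `|u - x| <= d / 2.
  by rewrite -(ler_pM2l k0); apply: le_trans ux _; rewrite expr2; lra.
have Uu : U u.
  apply: xr; rewrite -ball_normE/=.
  by have := ler_distD x xbar u; rewrite (distrC x u); lra.
have Vy : V y.
  apply: ys; rewrite -ball_normE/= distrC; apply: le_lt_trans yk _.
  move: xsc; rewrite ltr_pdivlMr ?mulr_gt0// => xsc.
  by have := ler_wpM2l (ltW c0) dx; lra.
have := le_trans (edist_to_triangle x u S) (leeD2l _ (subreg u Uu)).
rewrite leNgt => /negP; apply.
apply: (@le_lt_trans _ _ (d / 2 + kappa * (2 * c * d))%:E).
  rewrite EFinD leeD ?lee_fin ?(distrC x)// EFinM lee_pmul2l ?lte_fin//.
  apply: le_trans (edist_to_le _ _) _; first by split; [exact: yu|].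
  by rewrite lee_fin distrC.
rewrite dist lte_fin -/d.
move: ckappa; rewrite ltr_pdivlMr ?mulr_gt0// => ckappa.
have : d * (c * (4 * kappa)) < d * 1 by rewrite ltr_pM2l.
lra.
Qed.

Lemma subregular_of_quadratic_growth c U : 0 < c ->
  nbhs xbar U -> quadratic_growth_on f xbar ybar c U ->
  metrically_subregular_with (subdifferential f) xbar ybar (1 / c).
Proof.
move=> c0 xU growth; split=> //; first by rewrite divr_gt0.
(* The estimate holds for every subgradient at x, so no localization in the dual is needed; without
   subgradients the right side is +oo. *)
exists U, setT; split=> // [|x Ux]; first exact: filterT.
rewrite div1r lee_pdivlMl//; apply: le_ereal_inf_tmp => _ [y [yx _] <-].
have := growth x Ux; rewrite -/S dist -EFin_expe -!EFinM.
set d := fine (edist_to x S) => fx_ge.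
rewrite lee_fin leNgt; apply/negP => ltcd.
set N := `|ybar - y| in ltcd.
have N0 : 0 <= N by exact: normr_ge0.
have d0 : 0 < d by rewrite -(pmulr_rgt0 _ c0) (le_lt_trans N0).
have le_dist z : S z -> c * d ^+ 2 <= N * `|x - z|.
  (* [Sz.2 xbar] bounds f z above by the affine minorant, so the values of [f] cancel when the three
     inequalities are added. *)
  move=> Sz; have := yx.2 z; have := Sz.2 xbar; move: fx_ge.
  rewrite (fin yx.1) (fin ybarP.1) (fin Sz.1) -!EFinD !lee_fin.
  have : y (x - z) - ybar (x - z) <= N * `|x - z|.
    apply: le_trans (dual_norm_ub (ybar - y) (x - z)).
    have -> : (ybar - y) (x - z) = ybar (x - z) - y (x - z) by [].
    by rewrite ler_normr opprB lexx orbT.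
  rewrite !dual_subr; lra.
(* Positivity allows division by N, which turns [le_dist] into a lower bound for all |x - z| and
   thus for d. *)
have Npos : 0 < N.
  have := le_dist xbar ybarP.
  rewrite lt_def N0 andbT => h; apply: contraTneq h => ->.
  by rewrite mul0r -ltNge mulr_gt0// exprn_gt0.
have : ((c * d ^+ 2 / N)%:E <= edist_to x S)%E.
  apply: le_ereal_inf_tmp => _ [z Sz <-].
  by rewrite lee_fin ler_pdivrMr// [leRHS]mulrC le_dist.
rewrite dist lee_fin -/d ler_pdivrMr// expr2 mulrA (mulrC d) ler_pM2r//.
by rewrite leNgt ltcd.
Qed.

End growth_and_subregularity.

Theorem theorem2p1 (R : realType) (X : completeNormedModType R)
    (f : X -> \bar R) (xbar : X) (ybar : dual X)
    (fG : Gamma f) (ybarP : subdifferential f xbar ybar) :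
  [/\ metrically_subregular (subdifferential f) xbar ybar <->
        (exists U c, [/\ nbhs xbar U, 0 < c &
          quadratic_growth_on f xbar ybar c U]),
      (forall kappa, 0 < kappa ->
        metrically_subregular_with (subdifferential f) xbar ybar kappa ->
        forall c, c < 1 / (4 * kappa) ->
          exists2 U, nbhs xbar U & quadratic_growth_on f xbar ybar c U) &
      (forall c, 0 < c ->
        (exists2 U, nbhs xbar U & quadratic_growth_on f xbar ybar c U) ->
        metrically_subregular_with (subdifferential f) xbar ybar (1 / c))].
Proof.
split=> [|kappa kappa0 subreg c|c c0 [U xU growth]].
- split=> [[kappa subreg]|[U [c [xU c0 growth]]]]; last first.
    by exists (1 / c); exact: subregular_of_quadratic_growth xU growth.
  have [_ kappa0 _] := subreg.
  (* Any positive constant below 1 / (4 kappa) would do. *)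
  have c0 : 0 < 1 / (8 * kappa) by rewrite divr_gt0// mulr_gt0.
  have [|U xU growth] := quadratic_growth_of_subregular fG ybarP
      (c := 1 / (8 * kappa)) kappa0 subreg.
    by rewrite !div1r ltf_pV2 ?posrE ?mulr_gt0// ltr_pM2r// ltr_nat.
  by exists U, (1 / (8 * kappa)).
- exact: quadratic_growth_of_subregular.
- exact: subregular_of_quadratic_growth xU growth.
Qed.
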